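(* Let $k$ be an algebraically closed field, $d\geqslant 1$ an integer, and $\mathscr{T}$ a $k$-linear $\operatorname{Hom}$-finite $(d+2)$-angulated category with split idempotents which is $2d$-Calabi--Yau. Let $X\in\mathscr{T}$ be an object. Then: (1) if $X$ is Oppermann--Thomas cluster tilting in $\mathscr{T}$, then $X$ is $d$-self-perpendicular in $\mathscr{T}$; (2) if $X$ is $d$-self-perpendicular in $\mathscr{T}$, then $X$ is maximal $d$-rigid in $\mathscr{T}$.
   Context: $(d+2)$-angulated category: Put $n=d+2$. For an additive category $\mathscr{T}$ with an automorphism $\Sigma^d$ (the $d$-suspension; $\Sigma^{-d}=(\Sigma^d)^{-1}$, $\Sigma^{2d}=\Sigma^d\Sigma^d$), consider sequences $X_1\xrightarrow{\alpha_1}X_2\to\cdots\to X_n\xrightarrow{\alpha_n}\Sigma^dX_1$; a morphism of such sequences is a tuple $(\varphi_1,\dots,\varphi_n)$ making the ladder with last vertical map $\Sigma^d\varphi_1$ commute. $\mathscr{T}$ is $(d+2)$-angulated if it is equipped with a class of such sequences, called $(d+2)$-angles, such that: (F1) the class is closed under isomorphisms, direct sums and direct summands, contains $X\xrightarrow{1}X\to0\to\cdots\to0\to\Sigma^dX$ for each $X$, and each morphism is the first morphism $\alpha_1$ of some $(d+2)$-angle; (F2) a sequence is a $(d+2)$-angle iff its rotation $X_2\xrightarrow{\alpha_2}\cdots\to X_n\xrightarrow{\alpha_n}\Sigma^dX_1\xrightarrow{(-1)^n\Sigma^d\alpha_1}\Sigma^dX_2$ is; (F3) given two $(d+2)$-angles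 $(X_i,\alpha_i)$, $(Y_i,\beta_i)$ and $\varphi_1,\varphi_2$ with $\varphi_2\alpha_1=\beta_1\varphi_1$, there are $\varphi_3,\dots,\varphi_n$ completing these to a morphism; (F4) in (F3) the $\varphi_3,\dots,\varphi_n$ can be chosen so that the cone $X_2\oplus Y_1\to X_3\oplus Y_2\to\cdots\to\Sigma^dX_1\oplus Y_n\to\Sigma^dX_2\oplus\Sigma^dY_1$, with maps $\begin{pmatrix}-\alpha_{i+1}&0\\ \varphi_{i+1}&\beta_i\end{pmatrix}$ (where index $n+1$ means $\Sigma^d$ of index $1$), is a $(d+2)$-angle. $\mathscr{T}(X,Y)$ denotes the $\operatorname{Hom}$ space, $\operatorname{Ext}^d_{\mathscr{T}}(X,Y)=\mathscr{T}(X,\Sigma^dY)$, and $\operatorname{add}X$ is the class of direct summands of finite direct sums of copies of $X$. $\mathscr{T}$ is $2d$-Calabi--Yau if $\mathscr{T}(X,Y)\cong \operatorname{Hom}_k(\mathscr{T}(Y,\Sigma^{2d}X),k)$ naturally in $X,Y\in\mathscr{T}$. $X$ is $d$-rigid if $\operatorname{Ext}^d_{\mathscr{T}}(X,X)=0$. $X$ is Oppermann--Thomas cluster tilting in $\mathscr{T}$ if $X$ is $d$-rigid and for any $Y\in\mathscr{T}$ there exists a $(d+2)$-angle $X_d\to\cdots\to X_0\to Y\to\Sigma^dX_d$ with $X_i\in\operatorname{add}X$ for all $0\leq i\leq d$. $X$ is $d$-self-perpendicular in $\mathscr{T}$ if $\operatorname{add}X=\{Y\in\mathscr{T}\mid\operatorname{Ext}^d_{\mathscr{T}}(X,Y)=0\}$.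 $X$ is maximal $d$-rigid in $\mathscr{T}$ if $\operatorname{add}X=\{Y\in\mathscr{T}\mid\operatorname{Ext}^d_{\mathscr{T}}(X\oplus Y,X\oplus Y)=0\}$. *)

(* Defs.v *)
From mathcomp Require Import all_boot all_algebra.

Set Implicit Arguments.
Unset Strict Implicit.
Unset Printing Implicit Defensive.

Import GRing.Theory.
Local Open Scope ring_scope.

(* k-linear Hom-finite categories: the type vectType makes the morphism spaces
   finite dimensional.  [compm g f] is "g after f". *)
Record linCat (k : fieldType) := LinCat {
  ob :> Type;
  mor : ob -> ob -> vectType k;
  idm : forall A, mor A A;
  compm : forall A B C, mor B C -> mor A B -> mor A C;
  comp1m : forall A B (f : mor A B), compm (idm B) f = f;
  compm1 : forall A B (f : mor A B), compm f (idm A) = f;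
  compmA : forall A B C D (h : mor C D) (g : mor B C) (f : mor A B),
    compm h (compm g f) = compm (compm h g) f;
  comp_linear_l : forall A B C (f : mor A B),
    linear (fun g : mor B C => compm g f);
  comp_linear_r : forall A B C (g : mor B C),
    linear (fun f : mor A B => compm g f)
}.

Arguments mor {k l} _ _.
Arguments idm {k l} A.
Arguments compm {k l A B C} g f.

Notation "g \oc f" := (compm g f) (at level 40, left associativity).

Section Categories.
Variables (k : fieldType) (T : linCat k).
Implicit Types A B C : T.

(* Morphisms with varying source and target.  Equality in [arrow] is equality
   of morphisms of the category including their sources and targets. *)
Definition arrow := {AB : T * T & mor AB.1 AB.2}.
Definition Arrow A B (f : mor A B) : arrow :=
  existT (fun AB : T * T => mor AB.1 AB.2 : Type) (A, B) f.

Definition inverses A B (f : mor A B) (g : mor B A) :=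
  g \oc f = idm A /\ f \oc g = idm B.

Definition isomorphic A B := exists (f : mor A B) (g : mor B A), inverses f g.

Definition is_biproduct A B S (i1 : mor A S) (i2 : mor B S)
    (p1 : mor S A) (p2 : mor S B) :=
  [/\ p1 \oc i1 = idm A, p2 \oc i2 = idm B, p2 \oc i1 = 0, p1 \oc i2 = 0
    & i1 \oc p1 + i2 \oc p2 = idm S].

Definition split_idempotents :=
  forall A (e : mor A A), e \oc e = e ->
  exists B (p : mor A B) (i : mor B A), i \oc p = e /\ p \oc i = idm B.

Record functor := Functor {
  fobj :> T -> T;
  fmap : forall A B, mor A B -> mor (fobj A) (fobj B);
  fmap1 : forall A, fmap (idm A) = idm (fobj A);
  fmapM : forall A B C (g : mor B C) (f : mor A B),
    fmap (g \oc f) = fmap g \oc fmap f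
}.

(* An automorphism, with a strict inverse.  Compatibility with + is automatic
   for an automorphism of an additive category, so [aut_fmapD] is no
   restriction. *)
Record automorphism := Automorphism {
  aut :> functor;
  aut_inv : functor;
  autK : forall A B (f : mor A B), Arrow (fmap aut_inv (fmap aut f)) = Arrow f;
  aut_invK : forall A B (f : mor A B),
    Arrow (fmap aut (fmap aut_inv f)) = Arrow f;
  aut_fmapD : forall A B (f g : mor A B),
    fmap aut (f + g) = fmap aut f + fmap aut g
}.

End Categories.

Arguments fmap {k T} _ {A B} _.

Record addCat (k : fieldType) := AddCat {
  lcat :> linCat k;
  zob : lcat;
  zob_initial : forall A (f : mor zob A), f = 0;
  zob_terminal : forall A (f : mor A zob), f = 0;
  bip : lcat -> lcat -> lcat;
  in1 : forall A B, mor A (bip A B);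
  in2 : forall A B, mor B (bip A B);
  pr1 : forall A B, mor (bip A B) A;
  pr2 : forall A B, mor (bip A B) B;
  bipP : forall A B, is_biproduct (in1 A B) (in2 A B) (pr1 A B) (pr2 A B)
}.

Arguments zob {k} a.
Arguments bip {k a} A B.
Arguments in1 {k a A B}.
Arguments in2 {k a A B}.
Arguments pr1 {k a A B}.
Arguments pr2 {k a A B}.

(* The successor of an index, or None for the last one. *)
Definition osucc n (i : 'I_n) : option 'I_n :=
  (if i.+1 < n as b return (i.+1 < n) = b -> option 'I_n
   then fun lt_i1_n => Some (Ordinal lt_i1_n) else fun=> None)%N erefl.

Section Sequences.
Variables (k : fieldType) (d : nat) (T : addCat k) (S : automorphism T).

(* Sequences X_1 -> ... -> X_n -> S X_1 are indexed by 'I_n, with n = d + 2,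
   so that indices are shifted by one.  The convention that the index n + 1
   means S applied to the index 1 is implemented, for objects, families of
   morphisms X_i -> Y_i and families of morphisms X_i -> X_(i+1), by
   [nextO], [nextM] and [nextA]: their value at i is the object or morphism of
   index i + 1. *)
Local Notation n := d.+2.

Definition nextO (X : 'I_n -> T) (i : 'I_n) : T :=
  if osucc i is Some j then X j else S (X ord0).

Definition nextM (X Y : 'I_n -> T) (f : forall i, mor (X i) (Y i)) (i : 'I_n) :
    mor (nextO X i) (nextO Y i) :=
  match osucc i as o return
    mor (if o is Some j then X j else S (X ord0))
        (if o is Some j then Y j else S (Y ord0))
  with Some j => f j | None => fmap S (f ord0) end.

Definition nextA (X : 'I_n -> T) (a : forall i, mor (X i) (nextO X i)) :
    forall i : 'I_n, mor (nextO X i) (nextO (nextO X) i) :=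
  nextM a.

Record sequence := Sequence {
  sob :> 'I_n -> T;
  sarr : forall i, mor (sob i) (nextO sob i)
}.

Definition is_smor (X Y : sequence) (f : forall i, mor (X i) (Y i)) :=
  forall i, nextM f i \oc sarr X i = sarr Y i \oc f i.

Definition seq_isomorphic (X Y : sequence) :=
  exists (f : forall i, mor (X i) (Y i)) (g : forall i, mor (Y i) (X i)),
  [/\ is_smor f, is_smor g & forall i, inverses (f i) (g i)].

Definition seq_direct_sum (X Y Z : sequence) :=
  exists (i1 : forall i, mor (X i) (Z i)) (i2 : forall i, mor (Y i) (Z i))
         (p1 : forall i, mor (Z i) (X i)) (p2 : forall i, mor (Z i) (Y i)),
  [/\ is_smor i1, is_smor i2, is_smor p1, is_smor p2
    & forall i, is_biproduct (i1 i) (i2 i) (p1 i) (p2 i)].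

(* A = A -> 0 -> ... -> 0 -> S A *)
Definition triv_ob (A : T) (i : 'I_n) : T := if (i < 2)%N then A else zob T.

Definition triv_arr (A : T) (i : 'I_n) :
    mor (triv_ob A i) (nextO (triv_ob A) i) :=
  let: Ordinal m lt_mn := i in
  match m return forall lt_mn : (m < n)%N, let j := Ordinal lt_mn in
    mor (triv_ob A j) (nextO (triv_ob A) j)
  with 0%N => fun=> idm A | _.+1 => fun=> 0 end lt_mn.

Definition triv_seq (A : T) : sequence := Sequence (triv_arr A).

Definition rotation_arr (X : sequence) (i : 'I_n) :
    mor (nextO X i) (nextO (nextO X) i) :=
  (if osucc i is Some _ then 1 else (-1) ^+ n) *: nextA (sarr X) i.

Definition rotation (X : sequence) : sequence := Sequence (rotation_arr X).

Definition cone_ob (X Y : sequence) (i : 'I_n) : T := bip (nextO X i) (Y i).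

(* The target of the last map is S (X_2 (+) Y_1), which is the direct sum of
   S X_2 and S Y_1 through the images under S of the injections: this is why
   [nextM] is applied to the injections. *)
Definition cone_arr (X Y : sequence) (f : forall i, mor (X i) (Y i))
    (i : 'I_n) : mor (cone_ob X Y i) (nextO (cone_ob X Y) i) :=
  let inX := nextM (fun j => in1 : mor (nextO X j) (cone_ob X Y j)) i in
  let inY := nextM (fun j => in2 : mor (Y j) (cone_ob X Y j)) i in
  inX \oc (- nextA (sarr X) i) \oc pr1
  + inY \oc (nextM f i \oc pr1 + sarr Y i \oc pr2).

Definition cone (X Y : sequence) (f : forall i, mor (X i) (Y i)) : sequence :=
  Sequence (cone_arr f).

End Sequences.

(* In [angle_morphism] and [angle_cone], [f2] goes between the objects of
   index 2, and [nextM susp f ord0] is the component of index 2 of [f]. *)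
Record angCat (k : fieldType) (d : nat) := AngCat {
  acat :> addCat k;
  susp : automorphism acat;
  angle : sequence d susp -> Prop;
  angle_iso : forall X Y, seq_isomorphic X Y -> angle X -> angle Y;
  angle_sum : forall X Y Z,
    seq_direct_sum X Y Z -> angle X -> angle Y -> angle Z;
  angle_summand : forall X Y Z, seq_direct_sum X Y Z -> angle Z -> angle X;
  angle_triv : forall A, angle (triv_seq d susp A);
  angle_first : forall A B (f : mor A B),
    exists2 X, angle X & Arrow (sarr X ord0) = Arrow f;
  angle_rot : forall X, angle X <-> angle (rotation X);
  angle_morphism : forall X Y, angle X -> angle Y ->
    forall (f1 : mor (X ord0) (Y ord0))
           (f2 : mor (nextO susp X ord0) (nextO susp Y ord0)),
    f2 \oc sarr X ord0 = sarr Y ord0 \oc f1 ->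
    exists f : forall i, mor (X i) (Y i),
      [/\ is_smor f, f ord0 = f1 & nextM susp f ord0 = f2];
  angle_cone : forall X Y, angle X -> angle Y ->
    forall (f1 : mor (X ord0) (Y ord0))
           (f2 : mor (nextO susp X ord0) (nextO susp Y ord0)),
    f2 \oc sarr X ord0 = sarr Y ord0 \oc f1 ->
    exists f : forall i, mor (X i) (Y i),
      [/\ is_smor f, f ord0 = f1, nextM susp f ord0 = f2 & angle (cone f)]
}.

Arguments susp {k d} a.
Arguments angle {k d a} _.

Section AngulatedNotions.
Variables (k : fieldType) (d : nat) (T : angCat k d).
Local Notation S := (susp T).

Definition ext (X Y : T) : vectType k := mor X (S Y).

Definition ext_vanishes (X Y : T) := forall f : ext X Y, f = 0.

Definition copies (X : T) (m : nat) : T := iter m (bip X) (zob T).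

Definition in_add (X Y : T) :=
  exists (m : nat) (Z : T), isomorphic (bip Y Z) (copies X m).

(* Naturality is stated in both variables at once. *)
Definition calabi_yau :=
  exists phi : forall X Y : T, mor X Y -> 'Hom(mor Y (S (S X)), k^o),
  [/\ forall X Y, linear (phi X Y),
      forall X Y, bijective (phi X Y)
    & forall X X' Y Y' (f : mor X' X) (g : mor X Y) (h : mor Y Y')
             (t : mor Y' (S (S X'))),
      phi X' Y' (h \oc g \oc f) t =
      phi X Y g (fmap S (fmap S f) \oc t \oc h)].

Definition rigid (X : T) := ext_vanishes X X.

Definition ot_cluster_tilting (X : T) :=
  rigid X /\
  forall Y : T, exists A : sequence d S,
    [/\ angle A, A ord_max = Y & forall i, i != ord_max -> in_add X (A i)].

Definition self_perpendicular (X : T) :=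
  forall Y : T, in_add X Y <-> ext_vanishes X Y.

Definition maximal_rigid (X : T) :=
  forall Y : T, in_add X Y <-> ext_vanishes (bip X Y) (bip X Y).

End AngulatedNotions.

(* Main.v *)
Require Import Defs.
From mathcomp Require Import all_boot all_algebra.
From Stdlib Require Import Eqdep.

(** Each arrow of a (d+2)-angle is a weak kernel of the next one.  Let
    A_1 -> ... -> A_(d+1) -> Y -> S A_1 be an angle with all A_i in add X, and
    suppose Ext(X, Y) = 0.  By the Calabi-Yau property Hom(Y, S A_1) is dual to
    Hom(S A_1, S S Y) = Ext(A_1, Y) = 0, so the last arrow vanishes, the
    identity of Y lifts to A_(d+1), and Y is a summand of A_(d+1).  The other
    implications only use the additivity of Ext. *)

Set Implicit Arguments.
Unset Strict Implicit.
Unset Printing Implicit Defensive.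

Import GRing.Theory.
Local Open Scope ring_scope.

(** * Linear categories: weak kernels, retracts, automorphisms *)

Section LinearCategory.
Variables (k : fieldType) (T : linCat k).
Implicit Types A B C D : T.

Lemma compmDl A B C (f : mor A B) (g h : mor B C) :
  (g + h) \oc f = g \oc f + h \oc f.
Proof. by have := comp_linear_l f 1 g h; rewrite !scale1r. Qed.

Lemma compmDr A B C (f : mor B C) (g h : mor A B) :
  f \oc (g + h) = f \oc g + f \oc h.
Proof. by have := comp_linear_r f 1 g h; rewrite !scale1r. Qed.

Lemma comp0m A B C (f : mor A B) : (0 : mor B C) \oc f = 0.
Proof. by apply: (addrI (0 \oc f)); rewrite -compmDl !addr0. Qed.

Lemma compm0 A B C (f : mor B C) : f \oc (0 : mor A B) = 0.
Proof. by apply: (addrI (f \oc 0)); rewrite -compmDr !addr0. Qed.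

Lemma compmZl A B C a (f : mor A B) (g : mor B C) :
  (a *: g) \oc f = a *: (g \oc f).
Proof. by have := comp_linear_l f a g 0; rewrite !addr0 comp0m addr0. Qed.

Lemma compmZr A B C a (f : mor B C) (g : mor A B) :
  f \oc (a *: g) = a *: (f \oc g).
Proof. by have := comp_linear_r f a g 0; rewrite !addr0 compm0 addr0. Qed.

Lemma compmNl A B C (f : mor A B) (g : mor B C) : (- g) \oc f = - (g \oc f).
Proof. by rewrite -scaleN1r compmZl scaleN1r. Qed.

Lemma compmNr A B C (f : mor B C) (g : mor A B) : f \oc (- g) = - (f \oc g).
Proof. by rewrite -scaleN1r compmZr scaleN1r. Qed.

Definition weak_kernel A B C (a : mor A B) (b : mor B C) :=
  forall Y (f : mor Y B), b \oc f = 0 -> exists g : mor Y A, f = a \oc g.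

(** Serves to strip the signs that [rotation] puts on arrows: the scalar [c] moves into the lift. *)
Lemma weak_kernel_scale A B C c c' (a : mor A B) (b : mor B C) :
  weak_kernel (c *: a) (c' *: b) -> weak_kernel a b.
Proof.
move=> ab Y f bf0; have [|g ->] := ab Y f; first by rewrite compmZl bf0 scaler0.
by exists (c *: g); rewrite compmZl compmZr.
Qed.

Definition retract_of A B := exists (i : mor A B) (p : mor B A), p \oc i = idm A.

Lemma retract_trans A B C : retract_of A B -> retract_of B C -> retract_of A C.
Proof.
move=> [i [p pi1]] [j [q qj1]]; exists (j \oc i), (p \oc q).
by rewrite compmA -(compmA p q j) qj1 compm1.
Qed.

Lemma zero_from_retract A B C : retract_of A B ->
  (forall f : mor B C, f = 0) -> forall f : mor A C, f = 0.
Proof.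
by move=> [i [p pi1]] B0 f; rewrite -(compm1 f) -pi1 compmA (B0 (f \oc p)) comp0m.
Qed.

Lemma zero_to_retract A B C : retract_of A B ->
  (forall f : mor C B, f = 0) -> forall f : mor C A, f = 0.
Proof.
by move=> [i [p pi1]] B0 f; rewrite -(comp1m f) -pi1 -compmA (B0 (i \oc f)) compm0.
Qed.

(** Cancelling the endpoints uses uniqueness of identity proofs, the axiom behind [inj_pair2], as
    equality of objects need not be decidable. *)
Lemma Arrow_inj A B (f g : mor A B) : Arrow f = Arrow g -> f = g.
Proof. exact: inj_pair2. Qed.

Lemma Arrow_cast A B A' B' (f : mor A B) :
  A = A' -> B = B' -> exists g : mor A' B', Arrow g = Arrow f.
Proof. by move=> <- <-; exists f. Qed.

Lemma Arrow_fmap (F : functor T) A B C D (f : mor A B) (g : mor C D) :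
  Arrow f = Arrow g -> Arrow (fmap F f) = Arrow (fmap F g).
Proof. exact: (congr1 (fun u : arrow T => Arrow (fmap F (projT2 u)))). Qed.

Variable S : automorphism T.

Lemma aut_faithful A B (f g : mor A B) : fmap S f = fmap S g -> f = g.
Proof. by move=> eqS; apply: Arrow_inj; rewrite -(autK S f) eqS autK. Qed.

(** The preimage is the inverse functor applied to [g], transported along [invS] because its
    endpoints equal [A] and [B] only propositionally. *)
Lemma aut_full A B (g : mor (S A) (S B)) : exists f : mor A B, fmap S f = g.
Proof.
have invS C : aut_inv S (S C) = C.
  exact: (congr1 (fun u : arrow T => (projT1 u).1) (autK S (idm C))).
have [f eqf] := Arrow_cast (fmap (aut_inv S) g) (invS A) (invS B).
exists f; apply: Arrow_inj; rewrite -(aut_invK S g); exact: Arrow_fmap.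
Qed.

Lemma aut_fmap0 A B : fmap S (0 : mor A B) = 0.
Proof. by apply: (addrI (fmap S 0)); rewrite -aut_fmapD !addr0. Qed.

Lemma retract_aut A B : retract_of A B -> retract_of (S A) (S B).
Proof.
by move=> [i [p pi1]]; exists (fmap S i), (fmap S p); rewrite -fmapM pi1 fmap1.
Qed.

End LinearCategory.

(** * Biproducts and complements of retracts *)

Section AdditiveCategory.
Variables (k : fieldType) (T : addCat k).
Implicit Types A B C : T.

Lemma retract_bipl A B : retract_of A (bip A B).
Proof. by exists in1, pr1; case: (bipP A B). Qed.

Lemma retract_bipr A B : retract_of B (bip A B).
Proof. by exists in2, pr2; case: (bipP A B). Qed.

Lemma bip_zero_from A B C :
    (forall f : mor A C, f = 0) -> (forall f : mor B C, f = 0) ->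
  forall f : mor (bip A B) C, f = 0.
Proof.
move=> A0 B0 f; have [_ _ _ _ id_sum] := bipP A B.
rewrite -(compm1 f) -id_sum compmDr !compmA.
by rewrite (A0 (f \oc in1)) (B0 (f \oc in2)) !comp0m addr0.
Qed.

Lemma aut_bip_zero_to (S : automorphism T) A B C :
    (forall f : mor C (S A), f = 0) -> (forall f : mor C (S B), f = 0) ->
  forall f : mor C (S (bip A B)), f = 0.
Proof.
move=> A0 B0 f; have [_ _ _ _ id_sum] := bipP A B.
rewrite -(comp1m f) -fmap1 -id_sum aut_fmapD !fmapM compmDl -!compmA.
by rewrite (A0 (fmap S pr1 \oc f)) (B0 (fmap S pr2 \oc f)) !compm0 addr0.
Qed.

(** The complement [C] is the object through which the idempotent [1 - i p] splits; [p j = 0] and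
    [q i = 0] make the two splittings orthogonal. *)
Lemma split_retract A B : split_idempotents T -> retract_of A B ->
  exists C, isomorphic (bip A C) B.
Proof.
move=> T_split [i [p pi1]].
have eK : (idm B - i \oc p) \oc (idm B - i \oc p) = idm B - i \oc p.
  rewrite compmDl comp1m compmNl compmDr compm1 compmNr.
  by rewrite compmA -(compmA i p i) pi1 compm1 subrr oppr0 addr0.
have [C [q [j [jq qj1]]]] := T_split _ _ eK.
have pj0 : p \oc j = 0.
  rewrite -(compm1 j) -qj1 (compmA j) jq compmA compmDr compm1 compmNr compmA.
  by rewrite pi1 comp1m subrr comp0m.
have qi0 : q \oc i = 0.
  rewrite -(comp1m q) -qj1 -(compmA q) jq -compmA compmDl comp1m compmNl -compmA.
  by rewrite pi1 compm1 subrr compm0.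
have [p1i1 p2i2 p2i1 p1i2 id_sum] := bipP A C.
exists C, (i \oc pr1 + j \oc pr2), (in1 \oc p + in2 \oc q); split.
  rewrite compmDl !compmDr !compmA -!(compmA in1) -!(compmA in2).
  by rewrite pi1 pj0 qi0 qj1 !comp0m !comp1m !compm0 addr0 add0r.
rewrite compmDl !compmDr !compmA -!(compmA i) -!(compmA j).
by rewrite p1i1 p1i2 p2i1 p2i2 !comp0m !comp1m !compm0 addr0 add0r jq addrC subrK.
Qed.

End AdditiveCategory.

(** * Evaluation of the successor index *)

Lemma osucc_SomeP n (i j : 'I_n) : i.+1 = j -> osucc i = Some j.
Proof.
move=> ij; have lt_in : (i.+1 < n)%N by rewrite ij.
rewrite /osucc; move: (erefl _).
(* The left side of the equation passed to the dependent [if] is kept, so each branch still knows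
   the value of [i.+1 < n]. *)
case: {2 3}(i.+1 < n)%N => [lt_in'|]; last by rewrite lt_in.
by congr Some; apply: val_inj.
Qed.

Lemma osucc_max n : osucc (@ord_max n) = None.
Proof.
rewrite /osucc; move: (erefl _).
by case: {2 3}(_.+1 < n.+1)%N => // lt_nn; have := lt_nn; rewrite ltnn.
Qed.

(** * Exactness of angles *)

Section Exactness.
Variables (k : fieldType) (d : nat) (T : angCat k d).
Local Notation S := (susp T).
Implicit Types (B : sequence d S) (i j : 'I_d.+2).

(** This is exactness at the target of the arrow of index [i]; after the last arrow comes [S] of the
    first. *)
Definition exact_at B i := weak_kernel (sarr B i) (nextA (sarr B) i).

Lemma sign_scaleI (V : lmodType k) m (u v : V) :
  (-1) ^+ m *: u = (-1) ^+ m *: v -> u = v.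
Proof. by apply: scalerI; rewrite signr_eq0. Qed.

(** In the last square of a morphism of rotations, both rows carry the same sign [(-1)^n], which
    cancels. *)
Lemma smor_rotation_last B C (f : forall i, mor (rotation B i) (rotation C i)) i :
    osucc i = None -> is_smor f ->
  exists g : mor (S (B ord0)) (S (C ord0)),
    fmap S (f ord0) \oc fmap S (sarr B ord0) = fmap S (sarr C ord0) \oc g.
Proof.
move=> i_max /(_ i); move: (f i).
rewrite /= /rotation_arr /nextA /nextM /nextO.
case: (osucc i) i_max => // _ g; rewrite compmZl compmZr => /sign_scaleI.
by exists g.
Qed.

Lemma exact_first B : angle B -> exact_at B ord0.
Proof.
move=> B_angle Y f bf0.
(* Extend f to a morphism from the rotation of Y = Y -> 0 -> ... -> S Y to the
   rotation of B: its last component is S applied to a lift of f. *)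
have sq : (0 : mor (nextO S (rotation (triv_seq d S Y)) ord0)
                   (nextO S (rotation B) ord0))
      \oc sarr (rotation (triv_seq d S Y)) ord0
    = sarr (rotation B) ord0 \oc (f : mor (rotation (triv_seq d S Y) ord0) _).
  by rewrite comp0m /= /rotation_arr compmZl bf0 scaler0.
have [phi [phiP phi0 _]] := angle_morphism
  (proj1 (angle_rot _) (angle_triv Y)) (proj1 (angle_rot _) B_angle) sq.
have [g] := smor_rotation_last (osucc_max d.+1) phiP.
(* The first arrow of the trivial angle is an identity, so the last square exhibits [S f] as [S] of
   the first arrow of [B] after [g]; fullness and faithfulness then remove [S]. *)
rewrite phi0 fmap1 compm1; have [g' <-] := aut_full g.
by rewrite -fmapM => /aut_faithful ->; exists g'.
Qed.

Lemma exact_rotation B i j :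
  osucc i = Some j -> exact_at (rotation B) i -> exact_at B j.
Proof.
rewrite /exact_at /= /rotation_arr /nextA /nextM /nextO.
by case: (osucc i) => // _ [->] /weak_kernel_scale.
Qed.

(** Rotation preserves angles and lowers the index by one, so induction on the index, with [B]
    varying, reduces to the first arrow. *)
Lemma exact_angle B i : angle B -> exact_at B i.
Proof.
case: i => m lt_m; elim: m lt_m B => [|m IHm] lt_m B B_angle.
  by rewrite (_ : Ordinal _ = ord0); [apply: exact_first | apply: val_inj].
apply: (@exact_rotation B (Ordinal (ltnW lt_m))); first exact: osucc_SomeP.
by apply: IHm; apply: (proj1 (angle_rot B)).
Qed.

Lemma angle_retract B i j :
  angle B -> i.+1 = j -> sarr B j = 0 -> retract_of (B j) (B i).
Proof.
move=> B_angle /osucc_SomeP ij bj0.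
have := @exact_angle B i B_angle.
rewrite /exact_at /nextA /nextM; move: (sarr B i); rewrite /nextO.
case: (osucc i) ij => // _ [->] bi /(_ _ (idm _)); rewrite bj0 comp0m.
by case=> // g bg1; exists g, bi.
Qed.

End Exactness.

(** * Vanishing of Ext on add X and the two implications *)

Section Rigidity.
Variables (k : fieldType) (d : nat) (T : angCat k d).
Local Notation S := (susp T).
Implicit Types X Y Z : T.

Lemma ext_copies_l X Y m : ext_vanishes X Y -> ext_vanishes (copies X m) Y.
Proof.
move=> XY0; elim: m => [|m IHm] f; first exact: zob_initial.
exact: bip_zero_from.
Qed.

Lemma ext_copies_r X Y m : ext_vanishes Y X -> ext_vanishes Y (copies X m).
Proof.
move=> YX0; elim: m => [|m IHm] f; last exact: aut_bip_zero_to.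
(* [S] of the zero object need not be [zob T] itself, but its identity is [S 0 = 0]. *)
by rewrite -(comp1m f) -fmap1 (zob_initial (idm _)) aut_fmap0 comp0m.
Qed.

Lemma in_add_retract X Y : in_add X Y -> exists m, retract_of Y (copies X m).
Proof.
move=> [m [Z [f [g [gf1 fg1]]]]]; exists m.
by apply: retract_trans (retract_bipl Y Z) _; exists f, g.
Qed.

Lemma retract_in_add X Y m :
  split_idempotents T -> retract_of Y (copies X m) -> in_add X Y.
Proof. by move=> T_split /(split_retract T_split)[Z]; exists m, Z. Qed.

Lemma in_add_refl X : in_add X X.
Proof.
(* [copies X 1] unfolds to [bip X (zob T)], so identities suffice. *)
by exists 1, (zob T), (idm _), (idm _); split; rewrite comp1m.
Qed.

Lemma ext_in_add_l X Y Z : in_add X Y -> ext_vanishes X Z -> ext_vanishes Y Z.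
Proof.
move=> /in_add_retract[m YX] XZ0; apply: zero_from_retract YX _.
exact: ext_copies_l.
Qed.

Lemma ext_in_add_r X Y Z : in_add X Y -> ext_vanishes Z X -> ext_vanishes Z Y.
Proof.
move=> /in_add_retract[m YX] ZX0; apply: zero_to_retract (retract_aut S YX) _.
exact: ext_copies_r.
Qed.

(** Both [f] and 0 are sent by [phi] to functionals on a zero space, and [phi] is injective. *)
Lemma calabi_yau_zero X Y : calabi_yau T ->
  (forall f : mor Y (S (S X)), f = 0) -> forall f : mor X Y, f = 0.
Proof.
move=> [phi [phi_lin phi_bij _]] YX0 f; apply: (bij_inj (phi_bij X Y)).
by apply/lfunP => t; rewrite (YX0 t) !linear0.
Qed.

Lemma cluster_tilting_self_perpendicular X :
    split_idempotents T -> calabi_yau T ->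
  ot_cluster_tilting X -> self_perpendicular X.
Proof.
move=> T_split T_cy [XX0 tilt] Y; split=> [/ext_in_add_r|XY0]; first exact.
have [A [A_angle A_Y A_add]] := tilt Y; rewrite -{Y}A_Y in XY0 *.
(* Counting from 0, [d] is the last index but one, that of the object mapping to [Y]. *)
have A_d : (inord d : 'I_d.+2) != ord_max.
  by rewrite -val_eqE /= inordK ?ltn_eqF.
have h0 : sarr A ord_max = 0.
  move: (sarr A ord_max); rewrite /nextO osucc_max.
  (* By fullness [t] is [S u] with [u] in Ext(A_1, Y), which vanishes because A_1 lies in add X. *)
  apply: calabi_yau_zero => // t; have [u <-] := aut_full t.
  by rewrite (ext_in_add_l (A_add ord0 isT) XY0 u) aut_fmap0.
have [m A_dX] := in_add_retract (A_add _ A_d).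
apply: retract_in_add T_split (retract_trans _ A_dX).
by apply: angle_retract A_angle _ h0; rewrite inordK.
Qed.

(** Forwards, additivity splits the Ext of the sum into four terms: those out of X vanish by
    perpendicularity, and those out of Y follow since Y is in add X. Backwards, Ext(X, Y) is one of
    these terms. *)
Lemma self_perpendicular_maximal_rigid X :
  self_perpendicular X -> maximal_rigid X.
Proof.
move=> perpX Y; split=> [Y_add|XY0].
  have XX0 : ext_vanishes X X by apply/perpX/in_add_refl.
  have XY0 : ext_vanishes X Y by apply/perpX.
  have ext_sum Z : ext_vanishes X Z -> ext_vanishes (bip X Y) Z.
    by move=> XZ0; apply: bip_zero_from => //; apply: ext_in_add_l Y_add XZ0.
  by apply: aut_bip_zero_to; apply: ext_sum.
apply/perpX; apply: zero_from_retract (retract_bipl X Y) _.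
exact: zero_to_retract (retract_aut S (retract_bipr X Y)) _.
Qed.

End Rigidity.

Theorem theoremA (k : closedFieldType) (d : nat) (d_ge1 : (1 <= d)%N)
    (T : angCat k d) (T_split : split_idempotents T) (T_cy : calabi_yau T)
    (X : T) :
  (ot_cluster_tilting X -> self_perpendicular X) /\
  (self_perpendicular X -> maximal_rigid X).
Proof.
split; last exact: self_perpendicular_maximal_rigid.
exact: cluster_tilting_self_perpendicular.
Qed.
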